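(* Let $p$ be a prime, let $R=\left(\mathbb F_p[X,Y]/(XY)\right)_{(x,y)}$, where $x,y$ denote the images of $X,Y$, and set $t=x-y\in R$. Then $t$ is not a zero-divisor of $R$, $R/tR$ is $F$-coherent, and $R$ is not $F$-coherent.
   Context: For a ring $A$ of prime characteristic $p$ with Frobenius map $F(a)=a^p$, the perfect closure is $A^\infty=\varinjlim(A\xrightarrow{F}A\xrightarrow{F}\cdots)$. $A$ is called $F$-coherent if $A^\infty$ is a coherent ring, i.e. every finitely generated ideal of $A^\infty$ is finitely presented. *)

(* Defs.v *)
From Stdlib Require Import Lia.
From HB Require Import structures.
From mathcomp Require Import all_boot all_algebra.
From mathcomp Require Import boolp ring zify.

Set Implicit Arguments.
Unset Strict Implicit.
Unset Printing Implicit Defensive.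

Import GRing.Theory.
Local Open Scope ring_scope.
Local Open Scope quotient_scope.

(* boolp turns the Prop-valued predicates into the boolean ones
   that ideals and quotients require. *)

Section IdealGen.
Variable A : comNzRingType.

Definition ideal_gen (s : seq A) : {pred A} :=
  fun a => `[< exists c : 'I_(size s) -> A, a = \sum_i c i * s`_i >].

Lemma ideal_genP s a :
  reflect (exists c : 'I_(size s) -> A, a = \sum_i c i * s`_i)
          (a \in ideal_gen s).
Proof. exact: asboolP. Qed.

Lemma ideal_gen1P b a : reflect (exists c, a = c * b) (a \in ideal_gen [:: b]).
Proof.
apply: (iffP (ideal_genP _ _)) => [[c ->]|[c ->]].
  by exists (c ord0); rewrite big_ord1.
by exists (fun=> c); rewrite big_ord1.
Qed.

Lemma ideal_gen2P b1 b2 a :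
  reflect (exists c d, a = c * b1 + d * b2) (a \in ideal_gen [:: b1; b2]).
Proof.
apply: (iffP (ideal_genP _ _)) => [[c ->]|[c [d ->]]].
  by exists (c ord0), (c (lift ord0 ord0)); rewrite !big_ord_recl big_ord0 addr0.
exists (fun i => if i == ord0 then c else d).
by rewrite !big_ord_recl big_ord0 addr0.
Qed.

Lemma ideal_gen_idealr s : 1 \notin ideal_gen s -> idealr_closed (ideal_gen s).
Proof.
move=> s1; split=> //.
  by apply/ideal_genP; exists (fun=> 0); rewrite big1 // => i _; rewrite mul0r.
move=> a u v /ideal_genP[c ->] /ideal_genP[d ->]; apply/ideal_genP.
exists (fun i => a * c i + d i); rewrite big_distrr -big_split /=.
by apply: eq_bigr => i _; rewrite mulrDl mulrA.
Qed.

End IdealGen.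

(* Exactness of A^m -> A^n -> N -> 0, for N a submodule of M; the first arrow
   is right multiplication by B and the second is f. *)
Definition finitely_presented (A : comNzRingType) (M : lmodType A)
    (N : {pred M}) : Prop :=
  exists (m n : nat) (B : 'M[A]_(m, n)) (f : {linear 'rV[A]_n -> M}),
    (forall v, v \in N <-> exists u, v = f u) /\
    (forall u, f u = 0 <-> exists w : 'rV[A]_m, u = w *m B).

Definition coherent (A : comNzRingType) : Prop :=
  forall s : seq A, finitely_presented (ideal_gen s : {pred A^o}).

Module Localization.
Section Localization.
Variables (A : comNzRingType) (P : prime_idealr A).
Local Notation I := (P : pred A).

Definition denominator := {s : A | s \notin I}.
Local Notation frac := (A * denominator)%type.
Local Notation "'\n' x" := (x.1 : A) (at level 8, x at level 2).
Local Notation "'\d' x" := (sval x.2) (at level 8, x at level 2).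

Definition den1 : denominator := exist _ 1 (negbT (idealr1 P)).
Lemma denM_subproof (s t : denominator) : sval s * sval t \notin I.
Proof. by rewrite prime_idealrM negb_or (proj2_sig s) (proj2_sig t). Qed.
Definition denM s t : denominator := exist _ (sval s * sval t) (denM_subproof s t).

(* The factor u is needed because A may have zero-divisors. *)
Definition equiv (x y : frac) : bool :=
  `[< exists u : denominator, sval u * (\n x * \d y) = sval u * (\n y * \d x) >].

Lemma equiv_refl : reflexive equiv.
Proof. by move=> x; apply/asboolP; exists den1. Qed.
Lemma equiv_sym : symmetric equiv.
Proof. by move=> x y; apply/asboolP/asboolP => -[u e]; exists u. Qed.
Lemma equiv_trans : transitive equiv.
Proof.
move=> y x z /asboolP[u e] /asboolP[v f]; apply/asboolP.
exists (denM (denM u v) y.2) => /=.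
transitivity (sval v * \d z * (sval u * (\n x * \d y))); first by ring.
rewrite e; transitivity (sval u * \d x * (sval v * (\n y * \d z))); first by ring.
by rewrite f; ring.
Qed.

Canonical equiv_equivRel := EquivRel equiv equiv_refl equiv_sym equiv_trans.

Definition type := {eq_quot equiv}.
#[export]
HB.instance Definition _ : EqQuotient _ equiv type := EqQuotient.on type.
#[export]
HB.instance Definition _ := Choice.on type.

Lemma piP (x y : frac) :
  (exists u : denominator, sval u * (\n x * \d y) = sval u * (\n y * \d x)) <->
  \pi_type x = \pi_type y.
Proof.
by split=> [h|/eqmodP/asboolP//]; apply/eqmodP/asboolP.
Qed.

Definition addf (x y : frac) : frac :=
  (\n x * \d y + \n y * \d x, denM x.2 y.2).
Definition oppf (x : frac) : frac := (- \n x, x.2).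
Definition mulf (x y : frac) : frac := (\n x * \n y, denM x.2 y.2).

Definition zero : type := \pi_type (0, den1).
Definition one : type := \pi_type (1, den1).
Definition add (a b : type) : type := \pi_type (addf (repr a) (repr b)).
Definition opp (a : type) : type := \pi_type (oppf (repr a)).
Definition mul (a b : type) : type := \pi_type (mulf (repr a) (repr b)).

Lemma addE x y : add (\pi x) (\pi y) = \pi_type (addf x y).
Proof.
apply/piP; have /piP[u e] := reprK (\pi_type x).
have /piP[v f] := reprK (\pi_type y); exists (denM u v) => /=.
move: (repr (\pi_type x)) (repr (\pi_type y)) e f => x' y' e f.
transitivity (sval v * \d y * \d y' * (sval u * (\n x' * \d x))
  + sval u * \d x * \d x' * (sval v * (\n y' * \d y))); first by ring.
by rewrite e f; ring.
Qed.

Lemma oppE x : opp (\pi x) = \pi_type (oppf x).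
Proof.
apply/piP; have /piP[u e] := reprK (\pi_type x); exists u.
by move: (repr _) e => x' e /=; rewrite !mulNr !mulrN e.
Qed.

Lemma mulE x y : mul (\pi x) (\pi y) = \pi_type (mulf x y).
Proof.
apply/piP; have /piP[u e] := reprK (\pi_type x).
have /piP[v f] := reprK (\pi_type y); exists (denM u v) => /=.
move: (repr (\pi_type x)) (repr (\pi_type y)) e f => x' y' e f.
transitivity ((sval u * (\n x' * \d x)) * (sval v * (\n y' * \d y))); first by ring.
by rewrite e f; ring.
Qed.

Lemma addA : associative add.
Proof.
elim/quotW=> x; elim/quotW=> y; elim/quotW=> z; rewrite !addE.
by apply/piP; exists den1 => /=; ring.
Qed.
Lemma addC : commutative add.
Proof.
elim/quotW=> x; elim/quotW=> y; rewrite !addE.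
by apply/piP; exists den1 => /=; ring.
Qed.
Lemma add0 : left_id zero add.
Proof.
by elim/quotW=> x; rewrite addE; apply/piP; exists den1 => /=; ring.
Qed.
Lemma addN : left_inverse zero opp add.
Proof.
by elim/quotW=> x; rewrite oppE addE; apply/piP; exists den1 => /=; ring.
Qed.
#[export]
HB.instance Definition _ := GRing.isZmodule.Build type addA addC add0 addN.

Lemma mulA : associative mul.
Proof.
elim/quotW=> x; elim/quotW=> y; elim/quotW=> z; rewrite !mulE.
by apply/piP; exists den1 => /=; ring.
Qed.
Lemma mulC : commutative mul.
Proof.
elim/quotW=> x; elim/quotW=> y; rewrite !mulE.
by apply/piP; exists den1 => /=; ring.
Qed.
Lemma mul1 : left_id one mul.
Proof.
by elim/quotW=> x; rewrite mulE; apply/piP; exists den1 => /=; ring.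
Qed.
Lemma mulDl : left_distributive mul add.
Proof.
elim/quotW=> x; elim/quotW=> y; elim/quotW=> z; rewrite !(mulE, addE).
by apply/piP; exists den1 => /=; ring.
Qed.
Lemma one_neq0 : one != zero.
Proof.
apply/eqP => /piP[u] /=; rewrite !mulr1 mulr0 => u0.
by have := proj2_sig u; rewrite /= u0 idealr0.
Qed.
#[export]
HB.instance Definition _ :=
  GRing.Zmodule_isComNzRing.Build type mulA mulC mul1 mulDl one_neq0.

Definition to_loc (a : A) : type := \pi_type (a, den1).

Lemma to_loc_is_zmod_morphism : zmod_morphism to_loc.
Proof.
move=> a b; rewrite [RHS](_ : _ = add (to_loc a) (opp (to_loc b))) //.
by rewrite oppE addE; apply/piP; exists den1 => /=; ring.
Qed.
Lemma to_loc_is_monoid_morphism : monoid_morphism to_loc.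
Proof.
split=> // a b; rewrite [RHS](_ : _ = mul (to_loc a) (to_loc b)) //.
by rewrite mulE; apply/piP; exists den1 => /=; ring.
Qed.
#[export]
HB.instance Definition _ :=
  GRing.isZmodMorphism.Build A type to_loc to_loc_is_zmod_morphism.
#[export]
HB.instance Definition _ :=
  GRing.isMonoidMorphism.Build A type to_loc to_loc_is_monoid_morphism.

End Localization.
Module Exports. HB.reexport. End Exports.
End Localization.
Export Localization.Exports.
Notation localization := Localization.type.
Notation to_loc := Localization.to_loc.

(* The direct limit of A -f-> A -f-> A -f-> ...; the pair (i, a) stands for the
   image of the element a of the i-th copy of A. *)
Module Telescope.
Section Telescope.
Variables (A : comNzRingType) (f : {rmorphism A -> A}).

Local Notation elt := (nat * A)%type.

Definition equiv (x y : elt) : bool :=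
  `[< exists k, iter (k + y.1) f x.2 = iter (k + x.1) f y.2 >].

Lemma iter_add k a b : iter k f (a + b) = iter k f a + iter k f b.
Proof. by elim: k => //= k ->; rewrite rmorphD. Qed.
Lemma iter_opp k a : iter k f (- a) = - iter k f a.
Proof. by elim: k => //= k ->; rewrite rmorphN. Qed.
Lemma iter_mul k a b : iter k f (a * b) = iter k f a * iter k f b.
Proof. by elim: k => //= k ->; rewrite rmorphM. Qed.
Lemma iter_zero k : iter k f 0 = 0.
Proof. by elim: k => //= k ->; rewrite rmorph0. Qed.
Lemma iter_one k : iter k f 1 = 1.
Proof. by elim: k => //= k ->; rewrite rmorph1. Qed.

Lemma equiv_refl : reflexive equiv.
Proof. by move=> x; apply/asboolP; exists 0%N. Qed.
Lemma equiv_sym : symmetric equiv.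
Proof. by move=> x y; apply/asboolP/asboolP => -[k e]; exists k. Qed.
Lemma equiv_trans : transitive equiv.
Proof.
move=> y x z /asboolP[k e] /asboolP[l h]; apply/asboolP.
exists (k + l + y.1)%N.
rewrite (_ : k + l + y.1 + z.1 = l + z.1 + (k + y.1))%N; last by lia.
rewrite iterD e -iterD.
rewrite (_ : l + z.1 + (k + x.1) = k + x.1 + (l + z.1))%N; last by lia.
by rewrite iterD h -iterD; congr iter; lia.
Qed.

Canonical equiv_equivRel := EquivRel equiv equiv_refl equiv_sym equiv_trans.

Definition type := {eq_quot equiv}.
#[export]
HB.instance Definition _ : EqQuotient _ equiv type := EqQuotient.on type.
#[export]
HB.instance Definition _ := Choice.on type.

Lemma piP (x y : elt) :
  (exists k, iter (k + y.1) f x.2 = iter (k + x.1) f y.2) <->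
  \pi_type x = \pi_type y.
Proof.
by split=> [h|/eqmodP/asboolP//]; apply/eqmodP/asboolP.
Qed.

Definition liftop (op : A -> A -> A) (x y : elt) : elt :=
  ((x.1 + y.1)%N, op (iter y.1 f x.2) (iter x.1 f y.2)).
Definition oppf (x : elt) : elt := (x.1, - x.2).

Definition zero : type := \pi_type (0%N, 0).
Definition one : type := \pi_type (0%N, 1).
Definition add (a b : type) : type := \pi_type (liftop +%R (repr a) (repr b)).
Definition opp (a : type) : type := \pi_type (oppf (repr a)).
Definition mul (a b : type) : type := \pi_type (liftop *%R (repr a) (repr b)).

Lemma liftopE (op : A -> A -> A) x y :
    (forall k a b, iter k f (op a b) = op (iter k f a) (iter k f b)) ->
  \pi_type (liftop op (repr (\pi_type x)) (repr (\pi_type y))) =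
  \pi_type (liftop op x y).
Proof.
move=> opE; apply/piP; have /piP[k e] := reprK (\pi_type x).
have /piP[l h] := reprK (\pi_type y); exists (k + l)%N => /=.
move: (repr (\pi_type x)) (repr (\pi_type y)) e h => x' y' e h.
rewrite !opE -!iterD; congr op.
  rewrite (_ : _ + _ + _ = l + y.1 + y'.1 + (k + x.1))%N; last by lia.
  by rewrite iterD e -iterD; congr iter; lia.
rewrite (_ : _ + _ + _ = k + x.1 + x'.1 + (l + y.1))%N; last by lia.
by rewrite iterD h -iterD; congr iter; lia.
Qed.

Lemma addE x y : add (\pi x) (\pi y) = \pi_type (liftop +%R x y).
Proof. by apply: liftopE => k a b; rewrite iter_add. Qed.
Lemma mulE x y : mul (\pi x) (\pi y) = \pi_type (liftop *%R x y).
Proof. by apply: liftopE => k a b; rewrite iter_mul. Qed.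
Lemma oppE x : opp (\pi x) = \pi_type (oppf x).
Proof.
apply/piP; have /piP[k e] := reprK (\pi_type x); exists k.
by move: (repr _) e => x' e /=; rewrite !iter_opp e.
Qed.

Lemma addA : associative add.
Proof.
elim/quotW=> x; elim/quotW=> y; elim/quotW=> z; rewrite !addE.
by apply/piP; exists 0%N => /=; rewrite !iter_add -!iterD addrA;
   congr (iter _ f _ + iter _ f _ + iter _ f _); lia.
Qed.
Lemma addC : commutative add.
Proof.
elim/quotW=> x; elim/quotW=> y; rewrite !addE.
by apply/piP; exists 0%N => /=; rewrite addrC; congr iter; lia.
Qed.
Lemma add0 : left_id zero add.
Proof.
elim/quotW=> x; rewrite addE; apply/piP; exists 0%N => /=.
by rewrite iter_zero add0r.
Qed.
Lemma addN : left_inverse zero opp add.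
Proof.
elim/quotW=> x; rewrite oppE addE; apply/piP; exists 0%N => /=.
by rewrite iter_opp addNr !iter_zero.
Qed.
#[export]
HB.instance Definition _ := GRing.isZmodule.Build type addA addC add0 addN.

Lemma mulA : associative mul.
Proof.
elim/quotW=> x; elim/quotW=> y; elim/quotW=> z; rewrite !mulE.
by apply/piP; exists 0%N => /=; rewrite !iter_mul -!iterD mulrA;
   congr (iter _ f _ * iter _ f _ * iter _ f _); lia.
Qed.
Lemma mulC : commutative mul.
Proof.
elim/quotW=> x; elim/quotW=> y; rewrite !mulE.
by apply/piP; exists 0%N => /=; rewrite mulrC; congr iter; lia.
Qed.
Lemma mul1 : left_id one mul.
Proof.
elim/quotW=> x; rewrite mulE; apply/piP; exists 0%N => /=.
by rewrite iter_one mul1r.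
Qed.
Lemma mulDl : left_distributive mul add.
Proof.
elim/quotW=> x; elim/quotW=> y; elim/quotW=> z; rewrite !(mulE, addE).
apply/piP; exists 0%N => /=.
rewrite !(iter_mul, iter_add) -!iterD mulrDl.
by congr (iter _ f _ * iter _ f _ + iter _ f _ * iter _ f _); lia.
Qed.
Lemma one_neq0 : one != zero.
Proof.
apply/eqP => /piP[k] /=; rewrite iter_one iter_zero => /eqP.
by rewrite oner_eq0.
Qed.
#[export]
HB.instance Definition _ :=
  GRing.Zmodule_isComNzRing.Build type mulA mulC mul1 mulDl one_neq0.

End Telescope.
Module Exports. HB.reexport. End Exports.
End Telescope.
Export Telescope.Exports.
Notation telescope := Telescope.type.

Definition perfect_closure (A : comNzRingType) (p : nat)
    (charA : p \in [pchar A]) : comNzRingType :=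
  telescope (pFrobenius_aut charA).

Definition F_coherent (A : comNzRingType) (p : nat)
    (charA : p \in [pchar A]) : Prop :=
  coherent (perfect_closure charA).
Arguments F_coherent A {p} charA.

Section Node.
Variable p : nat.

(* Bivariate polynomials as in polyXY: the outer variable is X, the inner Y. *)
Local Notation FXY := {poly {poly 'F_p}}.
Local Notation "''Y'" := ('X%:P : FXY).

Definition ideal_XY : {pred FXY} := ideal_gen [:: 'X * 'Y].

Lemma ideal_XY_eval (f : FXY) : f \in ideal_XY -> f.[0].[0] = 0.
Proof.
by move=> /ideal_gen1P[g ->]; rewrite !hornerM hornerX horner0 mul0r mulr0.
Qed.

Lemma ideal_XY_idealr : idealr_closed ideal_XY.
Proof.
apply: ideal_gen_idealr; apply/negP => /ideal_XY_eval/eqP.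
by rewrite !hornerE oner_eq0.
Qed.
HB.instance Definition _ := isIdealr.Build FXY ideal_XY ideal_XY_idealr.

(* F_p[X,Y]/(XY), and its prime ideal (x, y). *)
Definition node : comNzRingType := {ideal_quot ideal_XY}.
Definition node_x : node := \pi_{ideal_quot ideal_XY} 'X.
Definition node_y : node := \pi_{ideal_quot ideal_XY} 'Y.

Definition node_origin : {pred node} := ideal_gen [:: node_x; node_y].

Lemma node_originP (f : FXY) :
  (\pi_{ideal_quot ideal_XY} f : node) \in node_origin = (f.[0].[0] == 0).
Proof.
apply/ideal_gen2P/eqP => [[c [d]]|f0].
  elim/quotW: c => g; elim/quotW: d => h.
  rewrite -!rmorphM -rmorphD => /eqP; rewrite -Quotient.idealrBE.
  move=> /ideal_XY_eval.
  by rewrite !(hornerE, mulr0, mul0r, addr0, subr0, oppr0) => /eqP/eqP.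
have /factor_theorem[g fE] : root (f - f.[0]%:P) 0.
  by rewrite /root !hornerE subrr.
have /factor_theorem[h hE] : root f.[0] 0 by rewrite /root f0.
exists (\pi_{ideal_quot ideal_XY} g), (\pi_{ideal_quot ideal_XY} h%:P).
rewrite -!rmorphM -rmorphD; congr (\pi_{ideal_quot ideal_XY} _).
by rewrite -[LHS](subrK f.[0]%:P) fE hE !polyC0 !subr0.
Qed.

Lemma node_origin_idealr : idealr_closed node_origin.
Proof.
apply: ideal_gen_idealr.
rewrite -[X in X \notin _](rmorph1 \pi_{ideal_quot ideal_XY}).
by rewrite [_ \in _]node_originP !hornerE oner_eq0.
Qed.
HB.instance Definition _ := isIdealr.Build node node_origin node_origin_idealr.

Lemma node_origin_prime : prime_idealr_closed node_origin.
Proof.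
elim/quotW=> f; elim/quotW=> g.
rewrite -[X in X \in _](rmorphM \pi_{ideal_quot ideal_XY}).
by rewrite ![_ \in _]node_originP !hornerM mulf_eq0.
Qed.
HB.instance Definition _ :=
  isPrimeIdealrClosed.Build node node_origin node_origin_prime.

(* The ring R = (F_p[X,Y]/(XY))_(x,y), with t = x - y; local_node_t is R/tR. *)
Definition local_node : comNzRingType := localization node_origin.
Definition local_x : local_node := to_loc node_origin node_x.
Definition local_y : local_node := to_loc node_origin node_y.
Definition local_t : local_node := local_x - local_y.

Definition ideal_t : {pred local_node} := ideal_gen [:: local_t].

Lemma ideal_t_idealr : idealr_closed ideal_t.
Proof.
apply: ideal_gen_idealr; apply/negP => /ideal_gen1P[c].
rewrite /local_t -rmorphB; elim/quotW: c => a e.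
have /Localization.piP[u /=] :
    \pi_local_node (1, Localization.den1 node_origin)
    = \pi_local_node (Localization.mulf a
        (node_x - node_y, Localization.den1 node_origin)).
  by rewrite -Localization.mulE.
rewrite !mulr1 mul1r => {}e.
have : sval u * sval a.2 \in node_origin.
  rewrite e mulrA idealMr //; apply/ideal_gen2P; exists 1, (-1).
  by rewrite mul1r mulN1r.
by rewrite prime_idealrM (negbTE (proj2_sig u)) (negbTE (proj2_sig a.2)).
Qed.
HB.instance Definition _ := isIdealr.Build local_node ideal_t ideal_t_idealr.

Definition local_node_t : comNzRingType := {ideal_quot ideal_t}.

Lemma pchar_local_node : prime p -> p \in [pchar local_node].
Proof.
move=> p_pr; apply: (rmorph_pchar (to_loc node_origin)).
apply: (rmorph_pchar \pi_{ideal_quot ideal_XY}).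
apply: (rmorph_pchar (polyC : {poly 'F_p} -> FXY)).
apply: (rmorph_pchar (polyC : 'F_p -> {poly 'F_p})).
exact: pchar_Fp.
Qed.

Lemma pchar_local_node_t : prime p -> p \in [pchar local_node_t].
Proof.
by move=> /pchar_local_node; apply: (rmorph_pchar \pi_{ideal_quot ideal_t}).
Qed.

End Node.

(* Main.v *)
Require Import Defs.
From HB Require Import structures.
From mathcomp Require Import all_boot all_algebra.
From mathcomp Require Import boolp ring zify.

Import GRing.Theory.
Local Open Scope ring_scope.
Local Open Scope quotient_scope.

(** Write $R$ for the local ring of the node, $x y = 0$.  Everything rests on
    one property of $R$: an element $c$ such that some $x^m c^n$ vanishes is a
    multiple of $y$, and symmetrically ([local_ann_x], [local_ann_y]).  For
    polynomials this is clear after setting $Y = 0$: in the domain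
    $F_p[X]$ only the image of $c$ can vanish.

    Regularity of $t = x - y$ ([local_t_regular]): if $t a = 0$ then
    $x^2 a = 0$, so $a = y d$; then $y^2 d = 0$, so $d$ is a multiple of $x$
    and $a = 0$.

    Coherence modulo $t$: $x = y$ squares to zero in $R/tR$, so an element of
    this local ring is invertible or killed by Frobenius
    ([local_node_t_nilpotent_or_unit]).  The perfect closure is then a field,
    whose only ideals are $0$ and $(1)$.

    Failure of coherence for $R$ ([not_F_coherent]): in a coherent ring the
    annihilator of an element is finitely generated ([coherent_annihilator]).
    In the perfect closure, an element annihilating $x$ is a multiple of
    $y^{1/p^k}$ for some $k$, so if the annihilator were finitely generated,
    a single $y^{1/p^K}$ would divide all of it, in particular
    $y^{1/p^{K+1}}$.  Raising to a power of $p$ would give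
    $y^n = y^{n+1} e$ in $R$, which is impossible ([local_y_pow]). *)

(** * Coherent rings *)

(** A field has only the ideals $0$ and $(1)$; both are free, on no generator
    and on one. *)
Lemma coherent_of_inverses (A : comNzRingType) :
  (forall a : A, a != 0 -> exists b, a * b = 1) -> coherent A.
Proof.
move=> inv s.
have [s0|/existsNP[a /not_implyP[/ideal_genP[c ac] /eqP a0]]] :=
    pselect (forall a, a \in ideal_gen s -> a = 0).
  have zlin : linear (fun _ : 'rV[A]_0 => 0 : A^o).
    by move=> k u v; rewrite scaler0 addr0.
  pose f : {linear 'rV[A]_0 -> A^o} :=
    HB.pack (fun _ : 'rV[A]_0 => 0 : A^o)
      (GRing.isLinear.Build _ _ _ _ _ zlin).
  exists 0%N, 0%N, 0, f; split=> [v|u].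
    split=> [/s0 ->|[u ->]]; first by exists 0.
    apply/ideal_genP; exists (fun=> 0).
    by rewrite big1 // => i _; rewrite mul0r.
  by split=> // _; exists 0; rewrite thinmx0 [RHS]thinmx0.
have [b ab] := inv a a0.
have elin : linear (fun u : 'rV[A]_1 => u 0 0 : A^o).
  by move=> k u v; rewrite !mxE.
pose f : {linear 'rV[A]_1 -> A^o} :=
  HB.pack (fun u : 'rV[A]_1 => u 0 0 : A^o)
    (GRing.isLinear.Build _ _ _ _ _ elin).
exists 0%N, 1%N, 0, f; split=> [v|u].
  split=> [_|_]; first by exists (const_mx v); rewrite /= mxE.
  apply/ideal_genP; exists (fun i => v * b * c i).
  transitivity (v * b * a); first by rewrite -mulrA (mulrC b) ab mulr1.
  by rewrite ac mulr_sumr; apply: eq_bigr => i _; rewrite mulrA.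
split=> [u0|[w ->]]; last by rewrite /= mulmx0 mxE.
exists 0; rewrite mul0mx; apply/rowP=> i; rewrite ord1 mxE; exact: u0.
Qed.

(** Schanuel's argument.  A presentation of $(x)$ maps each basis vector to some
    $a_i x$, hence factors as $u \mapsto \alpha(u) x$ with
    $\alpha(u) = \sum_i u_i a_i$, and $\alpha$ carries relations to
    annihilators of $x$.  With $u_0$ a preimage of $x$, write
    $z = z \alpha(u_0) + z (1 - \alpha(u_0))$: if $z x = 0$ then $z u_0$ is a
    relation, so $1 - \alpha(u_0)$ and the images of the given relations
    generate. *)
Lemma coherent_annihilator (A : comNzRingType) (x : A) : coherent A ->
  exists (n : nat) (g : 'I_n -> A),
    (forall i, x * g i = 0) /\
    (forall z, x * z = 0 -> exists h, z = \sum_i h i * g i).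
Proof.
move=> /(_ [:: x])[m [n [B [f [imf kerf]]]]].
have /imf[u0 u0x] : (x : A^o) \in (ideal_gen [:: x] : {pred A^o}).
  by apply/ideal_gen1P; exists 1; rewrite mul1r.
have /choice[a aE] : forall i : 'I_n, exists c, f (delta_mx 0 i) = c * x.
  by move=> i; apply/ideal_gen1P; apply/imf; exists (delta_mx 0 i).
pose al (u : 'rV[A]_n) := \sum_i u 0 i * a i.
have fE u : f u = al u * x.
  rewrite [in LHS](row_sum_delta u) linear_sum mulr_suml.
  by apply: eq_bigr => i _; rewrite linearZ /= aE [LHS]mulrA.
(* [ext t0 t] is the family t0, t 0, t 1, ... *)
pose ext (T : Type) (t0 : T) (t : 'I_m -> T) (i : 'I_m.+1) :=
  if unlift ord0 i is Some j then t j else t0.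
exists m.+1, (ext _ (1 - al u0) (fun j => al (row j B))); split.
  move=> i; rewrite /ext mulrC; case: unliftP => [j|] _.
    by rewrite -fE; apply/kerf; exists (delta_mx 0 j); rewrite rowE.
  by rewrite mulrBl mul1r -fE -u0x subrr.
move=> z; rewrite mulrC => zx.
have /kerf[w wB] : f (z *: u0) = 0.
  by rewrite linearZ /= -u0x.
exists (ext _ z (w 0)); rewrite big_ord_recl /ext unlift_none.
under eq_bigr => j _ do rewrite liftK.
suff -> : \sum_j w 0 j * al (row j B) = z * al u0 by ring.
transitivity (al (z *: u0)).
  rewrite wB /al; under eq_bigr => j _ do rewrite mulr_sumr.
  rewrite exchange_big; apply: eq_bigr => i _; rewrite mxE mulr_suml.
  by apply: eq_bigr => j _; rewrite mxE mulrA.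
by rewrite /al mulr_sumr; apply: eq_bigr => i _; rewrite mxE mulrA.
Qed.

(** * The perfect closure *)

Section PerfectClosure.
Variables (A : comNzRingType) (p : nat) (charA : p \in [pchar A]).

Let p_gt1 : (1 < p)%N. Proof. exact: prime_gt1 (pcharf_prime charA). Qed.
Let pexp_gt0 n : (0 < p ^ n)%N. Proof. by rewrite expn_gt0 ltnW. Qed.

(** The $p^k$-th root of the image of [a]: the class of [a] in the $k$-th copy
    of [A]. *)
Definition proot k (a : A) : perfect_closure charA :=
  \pi_(telescope (pFrobenius_aut charA)) (k, a).

Lemma proot_surj z : exists k a, z = proot k a.
Proof. by elim/quotW: z => -[k a]; exists k, a. Qed.

Lemma iter_pFrobenius n (a : A) :
  iter n (pFrobenius_aut charA) a = a ^+ (p ^ n).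
Proof.
elim: n => [|n IHn] /=; first by rewrite expr1.
by rewrite IHn pFrobenius_autE -exprM expnSr.
Qed.

Lemma proot_eq k a l b :
  proot k a = proot l b <-> exists n, a ^+ (p ^ (n + l)) = b ^+ (p ^ (n + k)).
Proof.
split=> [/Telescope.piP[n]|[n e]].
  by rewrite !iter_pFrobenius => e; exists n.
by apply/Telescope.piP; exists n; rewrite !iter_pFrobenius.
Qed.

Lemma proot0 k : proot k 0 = 0.
Proof.
rewrite [RHS](_ : _ = proot 0 0) //; apply/proot_eq; exists 0%N.
by rewrite !expr0n !expn_eq0 !(negbTE (lt0n_neq0 (ltnW p_gt1))).
Qed.

Lemma proot1 k : proot k 1 = 1.
Proof.
rewrite [RHS](_ : _ = proot 0 1) //; apply/proot_eq; exists 0%N.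
by rewrite !expr1n.
Qed.

Lemma proot_shift n k a : proot k a = proot (k + n) (a ^+ (p ^ n)).
Proof.
apply/proot_eq; exists 0%N; rewrite -exprM -expnD; congr (_ ^+ (_ ^ _)); lia.
Qed.

Lemma prootM k a b : proot k a * proot k b = proot k (a * b).
Proof.
rewrite (_ : _ * _ = Telescope.mul (proot k a) (proot k b)) // Telescope.mulE.
rewrite /Telescope.liftop /= !iter_pFrobenius -exprMn; exact/esym/proot_shift.
Qed.

Lemma proot_eq0 k a : proot k a = 0 <-> exists n, a ^+ (p ^ n) = 0.
Proof.
rewrite -(proot0 k); split=> [/proot_eq[n]|[n an]].
  rewrite [RHS]expr0n expn_eq0 (negbTE (lt0n_neq0 (ltnW p_gt1))) => e.
  by exists (n + k)%N.
by rewrite (proot_shift n) an proot0 proot0.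
Qed.

(** Elements killed by Frobenius die in the perfect closure, so under this
    hypothesis the perfect closure is a field. *)
Lemma F_coherent_of_nilpotent_or_unit :
  (forall a : A, a ^+ p = 0 \/ exists b, a * b = 1) -> F_coherent A charA.
Proof.
move=> H; apply: coherent_of_inverses => z z0.
have [k [a zE]] := proot_surj z; have [ap|[b ab]] := H a.
  by case/eqP: z0; rewrite zE; apply/proot_eq0; exists 1%N; rewrite expn1.
by exists (proot k b); rewrite zE prootM ab proot1.
Qed.

(** The annihilator of [x] in the perfect closure is the strictly increasing
    union of the ideals generated by the roots [proot k y], so it is not
    finitely generated. *)
Lemma not_F_coherent (x y : A) :
    x * y = 0 ->
    (forall m n c, x ^+ m * c ^+ n = 0 -> exists d, c = y * d) ->
    (forall n e, y ^+ n <> y ^+ n.+1 * e) ->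
  ~ F_coherent A charA.
Proof.
move=> xy annx ypow /(coherent_annihilator _ (proot 0 x))[n [g [xg gP]]].
have xroot k c : proot 0 x * proot k c = proot k (x ^+ (p ^ k) * c).
  by rewrite (proot_shift k 0) add0n prootM.
have /choice[k kP] : forall i, exists k, exists b, g i = proot k y * b.
  move=> i; have [k [c gE]] := proot_surj (g i); exists k.
  have := xg i; rewrite gE xroot => /proot_eq0[l]; rewrite exprMn -exprM.
  by move=> /annx[d ->]; exists (proot k d); rewrite prootM.
pose K := \max_i k i.
have {kP} gK i : exists b, g i = proot K y * b.
  have [b ->] := kP i; have kK : (k i <= K)%N by rewrite /K (leq_bigmax i).
  rewrite (proot_shift (K - k i)) subnKC //.
  case: (p ^ _)%N (pexp_gt0 (K - k i)) => // q _.
  by exists (proot K (y ^+ q) * b); rewrite exprS -prootM mulrA.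
(* All annihilators are now multiples of [proot K y]; the next root of [y]
   is one of them. *)
have [|h yE] := gP (proot K.+1 y).
  rewrite xroot; case: (p ^ _)%N (pexp_gt0 K.+1) => // q _.
  by rewrite exprSr -mulrA xy mulr0 proot0.
have [b bE] : exists b, proot K.+1 y = proot K y * b.
  have /choice[b gE] := gK; exists (\sum_i h i * b i).
  by rewrite yE mulr_sumr; apply: eq_bigr => i _; rewrite gE mulrCA.
have [l [e be]] := proot_surj b.
move: bE; rewrite be (proot_shift l K) (proot_shift K l) (addnC l) prootM.
case/proot_eq => j; rewrite exprMn -!exprM -expnD.
rewrite (_ : l + (j + K.+1) = (j + (K + l)).+1)%N; last by lia.
move: (j + (K + l))%N => r.
(* Both sides now live in [A]: y^(p^r) is a multiple of y^(p^(r+1)), and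
   p^r < p^(r+1). *)
have : (p ^ r < p ^ r.+1)%N by rewrite ltn_exp2l.
move=> /subnKC <-; rewrite exprD -mulrA; exact: ypow.
Qed.

End PerfectClosure.

(** * Fractions *)

Section Localization.
Variables (A : comNzRingType) (P : prime_idealr A).

Lemma to_loc_eq0 (a : A) :
  to_loc P a = 0 <-> exists u, u \notin (P : pred A) /\ u * a = 0.
Proof.
rewrite [X in _ = X](_ : _ = to_loc P 0) ?rmorph0 //; split.
  by case/Localization.piP => -[u uP] /=; rewrite mulr1 mul0r mulr0; exists u.
case=> u [uP ua]; apply/Localization.piP; exists (exist _ u uP) => /=.
by rewrite mulr1 mul0r mulr0.
Qed.

Lemma to_loc_unit (s : A) :
  s \notin (P : pred A) -> exists v, to_loc P s * v = 1.
Proof.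
move=> sP; exists (\pi_(localization P) (1, exist _ s sP)).
rewrite [LHS](_ : _ = Localization.mul (to_loc P s)
  (\pi_(localization P) (1, exist _ s sP))) // Localization.mulE.
by apply/Localization.piP; exists (Localization.den1 P) => /=; ring.
Qed.

(** The inverse of the denominator is given as an explicit element [v], so that
    a computation with fractions becomes one in a commutative ring with the
    relation [to_loc P s * v = 1]. *)
Lemma localization_fraction (z : localization P) :
  exists (a s : A) v,
    [/\ s \notin (P : pred A), to_loc P s * v = 1 & z = to_loc P a * v].
Proof.
elim/quotW: z => -[a [s sP]]; have [v sv] := to_loc_unit s sP.
exists a, s, v; split=> //.
set z := \pi _; suff zs : z * to_loc P s = to_loc P a.
  by rewrite -zs -mulrA sv mulr1.
rewrite [LHS](_ : _ = Localization.mul z (to_loc P s)) // Localization.mulE.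
by apply/Localization.piP; exists (Localization.den1 P) => /=; ring.
Qed.

(** The unit [u] in the hypothesis absorbs the factor that appears when an
    equality of fractions is brought back to [A]. *)
Lemma to_loc_annihilator (z w : A) :
    (forall (u c : A) m n, u \notin (P : pred A) ->
      u * (z ^+ m * c ^+ n) = 0 -> exists d, c = w * d) ->
  forall m n c, to_loc P z ^+ m * c ^+ n = 0 -> exists d, c = to_loc P w * d.
Proof.
move=> ann m n c; have [a [s [v [sP sv ->]]]] := localization_fraction c.
move=> e; have /to_loc_eq0[u [uP]] : to_loc P (z ^+ m * a ^+ n) = 0.
  rewrite rmorphM !rmorphXn -[RHS](mul0r (to_loc P s ^+ n)) -e.
  by rewrite exprMn -!mulrA -exprMn (mulrC v) sv expr1n mulr1.
by case/ann => // d ->; exists (to_loc P d * v); rewrite rmorphM mulrA.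
Qed.

Lemma to_loc_powers (z : A) n e : to_loc P z ^+ n = to_loc P z ^+ n.+1 * e ->
  exists u s a, [/\ u \notin (P : pred A), s \notin (P : pred A)
                  & u * (z ^+ n * (s - z * a)) = 0].
Proof.
have [a [s [v [sP sv ->]]]] := localization_fraction e => zn.
have /to_loc_eq0[u [uP us]] : to_loc P (z ^+ n * (s - z * a)) = 0.
  rewrite mulrBr mulrA -exprSr rmorphB !rmorphM !rmorphXn /= zn.
  by rewrite -!mulrA (mulrC v) sv mulr1 subrr.
by exists u, s, a.
Qed.

End Localization.

(** * The node *)

Lemma divX_of_eval0 (R : comNzRingType) (f : {poly R}) :
  f.[0] = 0 -> exists g, f = g * 'X.
Proof.
move=> f0; have /factor_theorem[g] : root f 0 by rewrite /root f0.
by rewrite subr0; exists g.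
Qed.

Lemma divY_of_eval0 (R : comNzRingType) (f : {poly {poly R}}) :
  map_poly (horner_eval 0) f = 0 -> exists g, f = g * 'X%:P.
Proof.
move=> f0; have /choice[g gE] : forall i, exists g, f`_i = g * 'X.
  move=> i; apply: divX_of_eval0.
  by have := congr1 (coefp i) f0; rewrite /= coef_map coef0.
exists (\poly_(i < size f) g i); apply/polyP=> i.
rewrite coefMC coef_poly; case: ltnP => [_|fi]; first exact: gE.
by rewrite mul0r nth_default.
Qed.

(** When $x y = 0$, the square of $c x + d y$ is $c^2 x^2 + d^2 y^2$, and
    both terms become multiples of $x y$ once $x$ and $y$ are identified. *)
Lemma image_nilpotent_or_unit (R S : comNzRingType) (q : {rmorphism R -> S})
    (x y z : R) :
    x * y = 0 -> q (x - y) = 0 ->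
    (exists b, z * b = 1) \/ (exists c d, z = c * x + d * y) ->
  q z ^+ 2 = 0 \/ exists b, q z * b = 1.
Proof.
move=> xy qt [[b zb]|[c [d zE]]]; [right|left].
  by exists (q b); rewrite -rmorphM zb rmorph1.
rewrite -rmorphXn.
have -> : z ^+ 2 = (x - y) * (c ^+ 2 * x - d ^+ 2 * y)
   + (x * y) * ((c + d) ^+ 2) by rewrite zE; ring.
by rewrite xy mul0r addr0 rmorphM qt mul0r.
Qed.

Section LocalNode.
Variable p : nat.
Local Notation FXY := {poly {poly 'F_p}}.
Local Notation npi := (\pi_{ideal_quot (@ideal_XY p)} : FXY -> node p).

Lemma node_pi_eq0 (f : FXY) : npi f = 0 <-> exists g, f = g * ('X * 'X%:P).
Proof.
rewrite -(rmorph0 \pi_{ideal_quot (@ideal_XY p)}).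
split=> [/eqP|[g e]].
  by rewrite -Quotient.idealrBE subr0 => /ideal_gen1P.
by apply/eqP; rewrite -Quotient.idealrBE subr0; apply/ideal_gen1P; exists g.
Qed.

Lemma node_xy : node_x p * node_y p = 0.
Proof.
by rewrite -rmorphM; apply/node_pi_eq0; exists 1; rewrite mul1r.
Qed.

(** Setting $Y = 0$ kills the multiples of $X Y$ and keeps [u] nonzero, since
    [u] does not vanish at the origin.  In the domain $F_p[X]$ it is then the
    image of [c] that vanishes. *)
Lemma node_ann_x (u c : node p) m n : u \notin @node_origin p ->
  u * (node_x p ^+ m * c ^+ n) = 0 -> exists d, c = node_y p * d.
Proof.
elim/quotW: u => u; elim/quotW: c => c.
rewrite node_originP => u0.
rewrite -!rmorphXn -!rmorphM => /node_pi_eq0[g].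
move/(congr1 (map_poly (horner_eval 0))).
rewrite !rmorphM !rmorphXn /= map_polyX map_polyC /= horner_evalE hornerX.
rewrite !mulr0 => /eqP; rewrite !mulf_eq0 !expf_eq0 polyX_eq0 andbF /=.
case/orP => [/eqP v0|/andP[_ /eqP/divY_of_eval0[d ->]]].
  case/eqP: u0; have := congr1 (fun q : {poly 'F_p} => q`_0) v0.
  by rewrite coef_map coef0 /= horner_evalE -horner_coef0.
by exists (npi d); rewrite -rmorphM mulrC.
Qed.

(** As [node_ann_x], setting $X = 0$. *)
Lemma node_ann_y (u c : node p) m n : u \notin @node_origin p ->
  u * (node_y p ^+ m * c ^+ n) = 0 -> exists d, c = node_x p * d.
Proof.
elim/quotW: u => u; elim/quotW: c => c.
rewrite node_originP => u0.
rewrite -!rmorphXn -!rmorphM => /node_pi_eq0[g].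
move/(congr1 (horner_eval 0)).
rewrite !horner_evalE !hornerM !horner_exp hornerX hornerC mul0r mulr0 => /eqP.
rewrite !mulf_eq0 !expf_eq0 polyX_eq0 andbF /=.
case/orP => [/eqP v0|/andP[_ /eqP/divX_of_eval0[d ->]]].
  by case/eqP: u0; rewrite v0 horner0.
by exists (npi d); rewrite -rmorphM mulrC.
Qed.

(** * The local ring of the node and its quotient by t *)

Local Notation x := (local_x p).
Local Notation y := (local_y p).

Lemma local_xy : x * y = 0.
Proof. by rewrite -rmorphM node_xy rmorph0. Qed.

Lemma local_ann_x m n (c : local_node p) :
  x ^+ m * c ^+ n = 0 -> exists d, c = y * d.
Proof. exact: to_loc_annihilator node_ann_x m n c. Qed.

Lemma local_ann_y m n (c : local_node p) :
  y ^+ m * c ^+ n = 0 -> exists d, c = x * d.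
Proof. exact: to_loc_annihilator node_ann_y m n c. Qed.

Lemma local_t_regular (a : local_node p) : local_t p * a = 0 -> a = 0.
Proof.
move=> ta.
have /(local_ann_x 2 1)[d ad] : x ^+ 2 * a ^+ 1 = 0.
  by transitivity (x * (local_t p * a) + x * y * a);
     [rewrite /local_t; ring | rewrite ta local_xy mulr0 mul0r addr0].
have /(local_ann_y 2 1)[e de] : y ^+ 2 * d ^+ 1 = 0.
  transitivity (x * y * d - local_t p * a); first by rewrite ad /local_t; ring.
  by rewrite ta local_xy mul0r subr0.
by rewrite ad de mulrA (mulrC y) local_xy mul0r.
Qed.

(** The ring is local with maximal ideal $(x, y)$. *)
Lemma local_dichotomy (z : local_node p) :
  (exists b, z * b = 1) \/ exists c d, z = c * x + d * y.
Proof.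
have [a [s [v [sP sv ->]]]] := localization_fraction _ _ z.
have [aP|aP] := boolP (a \in @node_origin p).
  right; have /ideal_gen2P[c [d ->]] := aP.
  exists (to_loc (@node_origin p) c * v), (to_loc (@node_origin p) d * v).
  by rewrite rmorphD !rmorphM /local_x /local_y; ring.
left; have [w aw] := to_loc_unit _ _ a aP.
exists (to_loc (@node_origin p) s * w).
by rewrite [to_loc _ s * w]mulrC mulrACA aw mul1r mulrC.
Qed.

(** With $e = a / s$, the equation would say that $y^n (s - y a)$ vanishes, so
    that $s - y a$ is a multiple of $x$; but the denominator $s$ is not in
    $(x, y)$. *)
Lemma local_y_pow n (e : local_node p) : y ^+ n <> y ^+ n.+1 * e.
Proof.
move=> /to_loc_powers[u [s [a [uP sP]]]]; rewrite -[s - _]expr1.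
case/(node_ann_y _ _ _ _ uP) => d sE.
case/negP: sP; apply/ideal_gen2P; exists d, a.
by rewrite [d * _]mulrC -sE (mulrC a) subrK.
Qed.

Lemma local_node_t_nilpotent_or_unit (p_pr : prime p) (z : local_node_t p) :
  z ^+ p = 0 \/ exists b, z * b = 1.
Proof.
elim/quotW: z => z.
have t0 : \pi_{ideal_quot (@ideal_t p)} (local_t p) = 0 :> local_node_t p.
  rewrite -(rmorph0 \pi_{ideal_quot (@ideal_t p)}).
  apply/eqP; rewrite -Quotient.idealrBE subr0; apply/ideal_gen1P.
  by exists 1; rewrite mul1r.
pose q := GRing.RMorphism.clone (local_node p) (local_node_t p)
  \pi_{ideal_quot (@ideal_t p)} _.
have := image_nilpotent_or_unit _ _ q _ _ _ local_xy t0 (local_dichotomy z).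
case=> [z2|]; last by right.
by left; rewrite -[X in _ ^+ X](subnKC (prime_gt1 p_pr)) exprD z2 mul0r.
Qed.

End LocalNode.

Theorem corollary4p7 (p : nat) (p_pr : prime p) :
  (forall a : local_node p, local_t p * a = 0 -> a = 0) /\
  F_coherent (local_node_t p) (pchar_local_node_t p_pr) /\
  ~ F_coherent (local_node p) (pchar_local_node p_pr).
Proof.
split; first exact: local_t_regular.
split.
  apply: F_coherent_of_nilpotent_or_unit.
  exact: (local_node_t_nilpotent_or_unit _ p_pr).
apply: (not_F_coherent _ _ _ (local_x p) (local_y p)).
- exact: local_xy.
- exact: local_ann_x.
- exact: local_y_pow.
Qed.
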